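(* Let $\mathcal T$ be a triangulation mixed with triangles and twin triangles. Consider the two-dimensional Euler equations of ideal gases with $\gamma>1$, and the set of admissible states $$\mathcal G=\left\{[\rho,m,n,E]^\top\in\mathbb R^4:\ \rho>0\ \text{and}\ p=(\gamma-1)\left(E-\frac{m^2+n^2}{2\rho}\right)>0\right\}.$$ Suppose that for each cell $T_0\in\mathcal T$ (with $J$ edges) the linear reconstruction with respect to the primitive variables satisfies $\boldsymbol u_j^-\in\mathcal G$ for $j=1,2,\dots,J$. Then the finite volume scheme $$\boldsymbol u_0^{n+1}=\boldsymbol u_0^n-\frac{\Delta t_n}{|T_0|}\sum_{j=1}^J\mathcal F(\boldsymbol u_j^-,\boldsymbol u_j^+;\boldsymbol n_j)\,|e_j|$$ with the local Lax–Friedrichs flux $$\mathcal F(\boldsymbol u_j^-,\boldsymbol u_j^+;\boldsymbol n_j)=\frac12\left[\boldsymbol F(\boldsymbol u_j^-)+\boldsymbol F(\boldsymbol u_j^+)\right]\cdot\boldsymbol n_j-\frac12 a\,(\boldsymbol u_j^+-\boldsymbol u_j^-),\qquad a=\big\||\boldsymbol v|+c\big\|_\infty,$$ satisfies $\boldsymbol u_0^{n+1}\in\mathcal G$ under the CFL condition $$a\,\Delta t_n\le\frac12\beta h,$$ where $h$ is the minimum size of the cells of $\mathcal T$ measured by the diameters of their inscribed circles, and $0<\beta\le1$ is sufficiently small such that $$\boldsymbol u_0^n-\beta(\boldsymbol u_1^-+\boldsymbol u_2^-+\boldsymbol u_3^-)\in\mathcal G$$ for any triangle $T_0$, and $$\boldsymbol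 u_0^n-\beta\left(\boldsymbol u_1^-+\boldsymbol u_2^-+\frac12\boldsymbol u_3^-+\frac12\boldsymbol u_4^-\right)\in\mathcal G$$ for any twin triangle $T_0$.
   Context: Equations. The Euler equations are $\partial_t\boldsymbol u+\nabla\cdot\boldsymbol F(\boldsymbol u)=\boldsymbol 0$ with $$\boldsymbol u=\begin{pmatrix}\rho\\ \rho u\\ \rho v\\ E\end{pmatrix},\quad \boldsymbol F(\boldsymbol u)=\begin{pmatrix}\rho u&\rho v\\ \rho u^2+p&\rho uv\\ \rho uv&\rho v^2+p\\ u(E+p)&v(E+p)\end{pmatrix},\quad p=(\gamma-1)\left(E-\tfrac12\rho|\boldsymbol v|^2\right),$$ where $\rho$ is the density, $\boldsymbol v=(u,v)$ the velocity, $E$ the total energy, $p$ the pressure, and $\gamma>1$ a constant; $c=\sqrt{\gamma p/\rho}$ is the speed of sound. $\boldsymbol F(\boldsymbol u)\cdot\boldsymbol n$ is the product of the $4\times2$ matrix $\boldsymbol F(\boldsymbol u)$ with the vector $\boldsymbol n\in\mathbb R^2$. Mesh. The cells of $\mathcal T$ are (geometric) triangles in $\mathbb R^2$. A cell of type ''triangle'' has $J=3$ edges $e_1,e_2,e_3$, its three sides. A cell of type ''twin triangle'' is a triangle one of whose sides is shared by two neighbors and is divided at its midpoint into two edges of equal length; it is treated as a (degenerate) quadrilateral with $J=4$ edges, where $e_1,e_2$ are the two undivided sides and $e_3,e_4$ are the two halves of the divided side (so $\boldsymbol n_3=\boldsymbol n_4$). Each edge $e_j$ of $T_0$ under consideration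 is an entire edge shared by $T_0$ and exactly one neighboring cell $T_j$ (interior edges, or edges identified through periodic boundary conditions), and it is counted as an edge, with the same midpoint, for both cells. The statement concerns cells all of whose edges are of this kind. $|T_0|$ is the area of $T_0$, $|e_j|$ the length of $e_j$, $\boldsymbol z_j$ the midpoint of $e_j$, and $\boldsymbol n_j$ the unit normal to $e_j$ outward from $T_0$. $\Delta t_n>0$ is the time step. Reconstruction. $\boldsymbol u_0^n$ is the cell average (in the conservative variables) on $T_0$ at time level $n$. On each cell $T_0$ with centroid $\boldsymbol x_0$, each primitive variable $q\in\{\rho,u,v,p\}$ is reconstructed as a linear function $\hat q_0(\boldsymbol x)=q_0+\boldsymbol L_q^\top(\boldsymbol x-\boldsymbol x_0)$, where $q_0$ is the value of the primitive variable corresponding to $\boldsymbol u_0^n$ and $\boldsymbol L_q\in\mathbb R^2$. The interior trace $\boldsymbol u_j^-$ is the vector of conservative variables corresponding to the reconstructed primitive values at $\boldsymbol z_j$; the exterior trace $\boldsymbol u_j^+$ is the state obtained in the same way at $\boldsymbol z_j$ from the reconstruction on the neighboring cell $T_j$ (that is, it is the interior trace of $T_j$ at that edge). The quantity $a=\||\boldsymbol v|+c\|_\infty$ is the maximum of $|\boldsymbol v|+c$ over all trace states $\boldsymbol u_j^\pm$ of the mesh at time level $n$. *)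

(* Defs.v *)
From mathcomp Require Import all_boot all_order all_algebra.
From mathcomp Require Import boolp classical_sets reals.

Set Implicit Arguments.
Unset Strict Implicit.
Unset Printing Implicit Defensive.

Import Order.TTheory GRing.Theory Num.Theory.
Local Open Scope classical_set_scope.
Local Open Scope ring_scope.

Section Euler.
Context {R : realType}.
Implicit Types (g : R) (u w : 'cV[R]_4) (x y n : 'cV[R]_2).

Definition dot x y : R := \sum_i x i 0 * y i 0.

Definition enorm x : R := Num.sqrt (dot x x).

Definition vec2 (a b : R) : 'cV[R]_2 := \col_i [:: a; b]`_i.
Definition vec4 (a b c d : R) : 'cV[R]_4 := \col_i [:: a; b; c; d]`_i.

(* Conservative variables (rho, rho u, rho v, E). *)
Definition density u : R := u 0 0.
Definition momx u : R := u 1 0.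
Definition momy u : R := u 2 0.
Definition energy u : R := u 3 0.

Definition velx u : R := momx u / density u.
Definition vely u : R := momy u / density u.
Definition velocity u : 'cV[R]_2 := vec2 (velx u) (vely u).

Definition pressure g u : R :=
  (g - 1) * (energy u - (momx u ^+ 2 + momy u ^+ 2) / (2 * density u)).

Definition sound_speed g u : R := Num.sqrt (g * pressure g u / density u).

Definition wave_speed g u : R := enorm (velocity u) + sound_speed g u.

Definition admissible g : set 'cV[R]_4 :=
  [set u | 0 < density u /\ 0 < pressure g u].

Definition euler_flux g u : 'M[R]_(4, 2) :=
  let r := density u in let vx := velx u in let vy := vely u in
  let E := energy u in let p := pressure g u in
  \matrix_(i < 4, j < 2)
    (nth [::] [:: [:: r * vx          ; r * vy          ];
                  [:: r * vx ^+ 2 + p ; r * vx * vy     ];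
                  [:: r * vx * vy     ; r * vy ^+ 2 + p ];
                  [:: vx * (E + p)    ; vy * (E + p)    ]] i)`_j.

Definition lax_friedrichs g (a : R) um up n : 'cV[R]_4 :=
  2^-1 *: ((euler_flux g um + euler_flux g up) *m n) - (2^-1 * a) *: (up - um).

(* Primitive variables (rho, u, v, p). *)
Definition prim_of_cons g u : 'cV[R]_4 :=
  vec4 (density u) (velx u) (vely u) (pressure g u).

Definition cons_of_prim g w : 'cV[R]_4 :=
  let r := w 0 0 in let vx := w 1 0 in let vy := w 2 0 in let p := w 3 0 in
  vec4 r (r * vx) (r * vy) (p / (g - 1) + 2^-1 * r * (vx ^+ 2 + vy ^+ 2)).

End Euler.

Section Geometry.
Variable R : realType.
Implicit Types (x p q : 'cV[R]_2).

Definition midpoint p q : 'cV[R]_2 := 2^-1 *: (p + q).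

Definition segment p q : set 'cV[R]_2 :=
  [set (1 - t) *: p + t *: q | t in [set t : R | 0 <= t <= 1]].

Definition disc x (r : R) : set 'cV[R]_2 := [set y | enorm (y - x) <= r].

(* A geometric triangle; if [twin], its side [pC, pA] is divided at the
   midpoint. The vertices may be listed in either orientation. *)
Record cell := Cell {
  pA : 'cV[R]_2;
  pB : 'cV[R]_2;
  pC : 'cV[R]_2;
  twin : bool }.

Implicit Types (K : cell) (j : nat).

Definition region K : set 'cV[R]_2 :=
  [set x | exists a b c : R,
    [/\ 0 <= a, 0 <= b, 0 <= c, a + b + c = 1
      & x = a *: pA K + b *: pB K + c *: pC K]].

Definition area K : R := `|\det (row_mx (pB K - pA K) (pC K - pA K))| / 2.

Definition centroid K : 'cV[R]_2 := 3^-1 *: (pA K + pB K + pC K).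

(* The inscribed circle is the largest circle contained in the triangle. *)
Definition incircle_diameter K : R :=
  sup [set d | exists x r, [/\ 0 <= r, disc x r `<=` region K & d = 2 * r]].

(* Vertices of the cell seen as a polygon: a twin triangle is a degenerate
   quadrilateral. Edge [j] (numbered from 0) joins corners [j] and [j + 1], so
   that the two halves of the divided side are the edges 2 and 3. *)
Definition corners K : seq 'cV[R]_2 :=
  if twin K then [:: pA K; pB K; pC K; midpoint (pC K) (pA K)]
  else [:: pA K; pB K; pC K].

Definition nedges K : nat := size (corners K).

Definition corner K j : 'cV[R]_2 := (corners K)`_(j %% nedges K).

Definition edge K j : set 'cV[R]_2 := segment (corner K j) (corner K j.+1).
Definition edge_length K j : R := enorm (corner K j.+1 - corner K j).
Definition edge_midpoint K j : 'cV[R]_2 :=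
  midpoint (corner K j) (corner K j.+1).

Definition outward_unit_normal K j (n : 'cV[R]_2) : Prop :=
  [/\ enorm n = 1,
      dot n (corner K j.+1 - corner K j) = 0
    & forall x, region K x -> dot n (x - corner K j) <= 0].

End Geometry.

(* [partner] maps an edge of a cell to the same edge seen from the neighboring
   cell; it is [None] on the part of the boundary without periodic conditions.
   Edges identified through periodic boundary conditions are translates of each
   other ([t <> 0] in [partner_translate]). *)
Record mesh (R : realType) := Mesh {
  cell_index : finType;
  geom :> cell_index -> cell R;
  normal : cell_index -> nat -> 'cV[R]_2;
  partner : {T : cell_index & 'I_(nedges (geom T))} ->
            option {T : cell_index & 'I_(nedges (geom T))};
  area_gt0 : forall T, 0 < area (geom T);
  normalP : forall T (j : 'I_(nedges (geom T))),
    outward_unit_normal (geom T) j (normal T j);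
  conforming : forall T T' x, T <> T' ->
    region (geom T) x -> region (geom T') x ->
    (x \in corners (geom T)) && (x \in corners (geom T')) \/
    exists (j : 'I_(nedges (geom T))) (j' : 'I_(nedges (geom T'))),
      edge (geom T) j = edge (geom T') j' /\ edge (geom T) j x;
  partner_sym : forall e e', partner e = Some e' -> partner e' = Some e;
  partner_translate : forall T j T' j',
    partner (existT _ T j) = Some (existT _ T' j') ->
    normal T' j' = - normal T j /\
    exists t : 'cV[R]_2,
      edge (geom T') j' = [set x + t | x in edge (geom T) j];
  partner_interior : forall T (j : 'I_(nedges (geom T)))
                            T' (j' : 'I_(nedges (geom T'))),
    T <> T' -> edge (geom T) j = edge (geom T') j' ->
    partner (existT _ T j) = Some (existT _ T' j');
  twin_neighbors : forall T (j3 j4 : 'I_(nedges (geom T))),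
    twin (geom T) -> j3 = 2 :> nat -> j4 = 3 :> nat ->
    exists e3 e4, [/\ partner (existT _ T j3) = Some e3,
                      partner (existT _ T j4) = Some e4
                    & tag e3 <> tag e4] }.

Section Scheme.
Variables (R : realType) (M : mesh R).
Implicit Types (T : cell_index M).

(* The mesh is finite, so that [inf] here and [sup] in [max_wave_speed] are a
   minimum and a maximum. *)
Definition mesh_size : R := inf (range (fun T => incircle_diameter (M T))).

Definition interior_cell T : Prop :=
  forall j : 'I_(nedges (M T)), partner (existT _ T j) <> None.

Variables (g : R).
(* Cell averages, and slopes of the reconstruction: the rows of [L T] are the
   transposed gradients of rho, u, v and p on [T]. *)
Variables (u : cell_index M -> 'cV[R]_4) (L : cell_index M -> 'M[R]_(4, 2)).

Definition reconstruction T (x : 'cV[R]_2) : 'cV[R]_4 :=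
  prim_of_cons g (u T) + L T *m (x - centroid (M T)).

Definition interior_trace T (j : nat) : 'cV[R]_4 :=
  cons_of_prim g (reconstruction T (edge_midpoint (M T) j)).

(* Only meaningful on shared edges; elsewhere the value is set to the interior
   trace, which adds nothing to [max_wave_speed]. *)
Definition exterior_trace T (j : 'I_(nedges (M T))) : 'cV[R]_4 :=
  if partner (existT _ T j) is Some e
  then interior_trace (tag e) (tagged e) else interior_trace T j.

Definition max_wave_speed : R :=
  sup [set s | exists T (j : 'I_(nedges (M T))),
    s = wave_speed g (interior_trace T j) \/
    s = wave_speed g (exterior_trace j)].

Definition fv_step (dt : R) T : 'cV[R]_4 :=
  u T - (dt / area (M T)) *: \sum_(j < nedges (M T))
    edge_length (M T) j *:
      lax_friedrichs g max_wave_speed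
        (interior_trace T j) (exterior_trace j) (normal T j).

End Scheme.

(* Main.v *)
Require Import Defs.
From mathcomp Require Import all_boot all_order all_algebra.
From mathcomp Require Import boolp classical_sets reals.
From mathcomp Require Import ring lra.

Import Order.TTheory GRing.Theory Num.Theory.
Local Open Scope ring_scope.

(** The admissible set is a convex cone: the pressure is, up to the factor
    [g - 1], the energy minus the kinetic energy, and the kinetic energy is a
    sublinear function of density and momentum ([admissible_addZ]).  A second
    fact is that [a *: w - F(w) n] is admissible when [w] is, [n] is a unit
    vector and [a] is at least the wave speed of [w]
    ([admissible_flux_splitting]).

    The Lax-Friedrichs flux contributes to the update, for each edge, a nonnegative
    multiple [k] of
    [ (a u+ - F(u+) n) - (a u- + F(u-) n)
      = (a u+ - F(u+) n) + (a u- - F(u-) n) - 2 a u-, ]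
    with [k = dt |e| / (2 |T|)].  The first two terms are admissible by the flux
    splitting, whatever the direction of the normals, so that the only harmful
    part is [- 2 k a u- = - (a dt |e| / |T|) u-].  The assumption on [beta] says
    that the cell average stays admissible after [beta s u-] has been removed
    for each edge, where the share [s] is 1 for a whole side and 1/2 for half of
    a divided side.  It remains to see that [a dt |e| / |T| <= beta s]
    ([CFL_edge]); the difference of the two sides is then a nonnegative
    coefficient in front of the admissible state [u-].

    The last inequality is plane geometry.  A disc of radius [r] contained in a
    triangle satisfies [r P <= 2 |T|], where [P] is the perimeter
    ([inscribed_disc]), so [h <= 4 |T| / P].  By the triangle inequality a side
    is at most half of the perimeter, hence [2 |e| <= s P]
    ([edge_length_le]).  Together with [a dt <= beta h / 2] this gives
    [a dt |e| <= beta (2 |T| / P) (s P / 2) = beta s |T|]. *)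

(** * Norms, cross products and discs in the plane *)

Section Plane.
Context {R : realType}.
Implicit Types x y z A B C : 'cV[R]_2.

Lemma dotE x y : dot x y = x 0 0 * y 0 0 + x 1 0 * y 1 0.
Proof.
rewrite /dot !big_ord_recl big_ord0 addr0.
by congr (_ + x _ _ * y _ _); apply/val_inj.
Qed.

Lemma dotxx_ge0 x : 0 <= dot x x.
Proof. by rewrite dotE -!expr2 addr_ge0 ?sqr_ge0. Qed.

Lemma enorm_ge0 x : 0 <= enorm x.
Proof. exact: sqrtr_ge0. Qed.

Lemma enorm_sqr x : enorm x ^+ 2 = dot x x.
Proof. by rewrite sqr_sqrtr ?dotxx_ge0. Qed.

Lemma dot_le_enorm x y : dot x y <= enorm x * enorm y.
Proof.
rewrite (le_trans (ler_norm _)) // -sqrtr_sqr -sqrtrM ?dotxx_ge0 //.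
apply: ler_wsqrtr; rewrite !dotE -subr_ge0.
have -> : (x 0 0 * x 0 0 + x 1 0 * x 1 0) * (y 0 0 * y 0 0 + y 1 0 * y 1 0)
  - (x 0 0 * y 0 0 + x 1 0 * y 1 0) ^+ 2
  = (x 0 0 * y 1 0 - x 1 0 * y 0 0) ^+ 2 by ring.
exact: sqr_ge0.
Qed.

Lemma enormD x y : enorm (x + y) <= enorm x + enorm y.
Proof.
rewrite -(@ler_pXn2r _ 2) ?nnegrE ?addr_ge0 ?enorm_ge0 //.
have -> : enorm (x + y) ^+ 2 = enorm x ^+ 2 + 2 * dot x y + enorm y ^+ 2.
  by rewrite !enorm_sqr !dotE !mxE; ring.
by have := dot_le_enorm x y; lra.
Qed.

Lemma enormZ (k : R) x : enorm (k *: x) = `|k| * enorm x.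
Proof.
rewrite /enorm -sqrtr_sqr -sqrtrM ?sqr_ge0 //; congr Num.sqrt.
by rewrite !dotE !mxE; ring.
Qed.

Lemma enormN x : enorm (- x) = enorm x.
Proof. by rewrite -scaleN1r enormZ normrN1 mul1r. Qed.

Definition cross x y : R := x 0 0 * y 1 0 - x 1 0 * y 0 0.

Definition perp x : 'cV[R]_2 := vec2 (- x 1 0) (x 0 0).

Lemma perp0 x : perp x 0 0 = - x 1 0. Proof. by rewrite mxE. Qed.

Lemma perp1 x : perp x 1 0 = x 0 0. Proof. by rewrite mxE. Qed.

Lemma enorm_perp x : enorm (perp x) = enorm x.
Proof. by rewrite /enorm; congr Num.sqrt; rewrite !dotE perp0 perp1; ring. Qed.

Lemma cross_dot x y : cross x y = dot (perp x) y.
Proof. by rewrite dotE perp0 perp1 /cross; ring. Qed.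

Lemma cross_eq0_enorm x y : enorm x = 0 -> cross x y = 0.
Proof.
move=> x0; apply/eqP; rewrite eq_le -oppr_le0 !cross_dot.
have -> : - dot (perp x) y = dot (perp x) (- y) by rewrite !dotE !mxE; ring.
by rewrite !(le_trans (dot_le_enorm _ _)) // enorm_perp x0 mul0r.
Qed.

(** The centre of a disc contained in a half-plane is at distance at least [r]
    from the bounding line.  The line has direction [e], the sign [s] tells the
    side, and [s * cross e (x - p)] is the distance times [enorm e]. *)
Lemma disc_halfplane (s : R) e p x (r : R) : 0 <= r -> s ^+ 2 = 1 ->
    (forall y, disc x r y -> 0 <= s * cross e (y - p)) ->
  r * enorm e <= s * cross e (x - p).
Proof.
move=> r0 s1 H; have ns : `|s| = 1.
  by apply/eqP; rewrite -sqrp_eq1 // -normrX s1 normr1.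
have [e0|e_gt0] := leP (enorm e) 0.
  have -> : enorm e = 0 by apply/le_anti; rewrite e0 enorm_ge0.
  rewrite mulr0; apply: H; rewrite /disc /= subrr.
  by rewrite -(scale0r x) enormZ normr0 mul0r.
(* The point of the disc at which [s * cross e (y - p)] is smallest. *)
set y := x - (r * s / enorm e) *: perp e.
have := H y; rewrite /disc /=.
have -> : y - x = (- (r * s / enorm e)) *: perp e.
  by rewrite /y scaleNr addrAC subrr add0r.
rewrite enormZ enorm_perp normrN !normrM ns mulr1 normfV.
rewrite !ger0_norm ?enorm_ge0 //; rewrite divfK ?gt_eqF // => /(_ (lexx _)).
have -> : cross e (y - p) = cross e (x - p) - r * s / enorm e * enorm e ^+ 2.
  rewrite enorm_sqr dotE /y.
  rewrite /cross [(x - _ - p) 0 0]mxE [(x - _ - p) 1 0]mxE.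
  by rewrite !mxE /=; ring.
rewrite mulrBr.
have -> : s * (r * s / enorm e * enorm e ^+ 2) = s ^+ 2 * (r * enorm e).
  by field; rewrite gt_eqF.
by rewrite s1 mul1r subr_ge0.
Qed.

End Plane.

(** * Perimeter, area and inscribed discs of a triangle *)

Section Triangle.
Context {R : realType}.
Implicit Types K : cell R.

Definition perimeter K : R :=
  enorm (pB K - pA K) + enorm (pC K - pB K) + enorm (pA K - pC K).

Lemma areaE K : area K = `|cross (pB K - pA K) (pC K - pA K)| / 2.
Proof.
have row_mx2E (x y : 'cV[R]_2) i (k : 'I_(1 + 1)) :
    row_mx x y i k = if k == 0 :> nat then x i 0 else y i 0.
  by rewrite mxE; case: splitP => l ->; rewrite (ord1 l).
rewrite /area (expand_det_row _ 0) !big_ord_recl big_ord0 /cofactor !det_mx11.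
have minorE (A : 'M[R]_2) i k : row' i (col' k A) 0 0 = A (lift i 0) (lift k 0).
  by rewrite !mxE.
rewrite !minorE !row_mx2E /=.
rewrite [lift 0 0](_ : _ = 1); last exact/val_inj.
by congr (`| _ | / 2); rewrite /cross /bump /= !mxE; ring.
Qed.

(** The three cross products of a point with barycentric coordinates [a, b, c]
    are [c D], [a D] and [b D]; the sign of [D] accounts for the orientation in
    which the vertices are listed. *)
Lemma region_cross K y (D := cross (pB K - pA K) (pC K - pA K)) : region K y ->
  [/\ 0 <= Num.sg D * cross (pB K - pA K) (y - pA K),
      0 <= Num.sg D * cross (pC K - pB K) (y - pB K)
    & 0 <= Num.sg D * cross (pA K - pC K) (y - pC K)].
Proof.
case=> a [b [c [a0 b0 c0 abc ->]]].
have Dge : 0 <= Num.sg D * D by rewrite -normrEsg.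
have ea : a = 1 - b - c by rewrite -abc; ring.
have -> : cross (pB K - pA K) (a *: pA K + b *: pB K + c *: pC K - pA K)
    = c * D.
  by rewrite /D ea /cross !mxE; ring.
have -> : cross (pC K - pB K) (a *: pA K + b *: pB K + c *: pC K - pB K)
    = a * D.
  by rewrite /D ea /cross !mxE; ring.
have -> : cross (pA K - pC K) (a *: pA K + b *: pB K + c *: pC K - pC K)
    = b * D.
  by rewrite /D ea /cross !mxE; ring.
by split; rewrite mulrCA mulr_ge0.
Qed.

(** The centre of the disc splits the triangle into three triangles standing on
    the sides, each of height at least [r]; their areas add up to that of the
    whole. *)
Lemma inscribed_disc K x (r : R) : 0 < area K -> 0 <= r ->
  (disc x r `<=` region K)%classic -> r * perimeter K <= 2 * area K.
Proof.
rewrite areaE => K0 r0 sub; rewrite [2 * _]mulrC divfK ?pnatr_eq0 //.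
set D := cross _ _ in K0 *.
have D0 : D != 0 by rewrite -normr_gt0; move: K0; lra.
have s1 : Num.sg D ^+ 2 = 1 by rewrite sqr_sg D0.
have support y (h : disc x r y) := region_cross K y (sub y h).
have cAB : r * enorm (pB K - pA K) <= Num.sg D * cross (pB K - pA K) (x - pA K).
  by apply: disc_halfplane => // y /support[].
have cBC : r * enorm (pC K - pB K) <= Num.sg D * cross (pC K - pB K) (x - pB K).
  by apply: disc_halfplane => // y /support[].
have cCA : r * enorm (pA K - pC K) <= Num.sg D * cross (pA K - pC K) (x - pC K).
  by apply: disc_halfplane => // y /support[].
rewrite /perimeter !mulrDr (le_trans (lerD (lerD cAB cBC) cCA)) //.
rewrite normrEsg -/D -!mulrDr le_eqVlt; apply/orP; left; apply/eqP.
by congr (_ * _); rewrite /D /cross !mxE; ring.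
Qed.

Lemma perimeter_gt0 K : 0 < area K -> 0 < perimeter K.
Proof.
rewrite areaE /perimeter => K0.
have := enorm_ge0 (pB K - pA K).
rewrite le_eqVlt => /orP[/eqP/esym e0|e_gt0].
  by move: K0; rewrite cross_eq0_enorm // normr0 mul0r ltxx.
have := enorm_ge0 (pC K - pB K); have := enorm_ge0 (pA K - pC K); lra.
Qed.

(** The weight of the trace of edge [j] in the admissibility assumption on
    [beta]. *)
Definition edge_share K (j : nat) : R :=
  if twin K && (1 < j)%N then 2^-1 else 1.

(** A side is at most the sum of the two others, that is, at most half of the
    perimeter; half of a side is at most a quarter of it. *)
Lemma edge_length_le K (j : 'I_(nedges K)) :
  2 * edge_length K j <= edge_share K j * perimeter K.
Proof.
have tri (A B C : 'cV[R]_2) : enorm (B - A) <= enorm (C - B) + enorm (A - C).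
  rewrite -(enormN (B - A)) (_ : - (B - A) = (C - B) + (A - C)) ?enormD //.
  by rewrite opprB [RHS]addrC subrKA.
case: K j => A B C [] [[|[|[|[|j]]]] //= lt];
  rewrite /edge_length /edge_share /perimeter /corner /nedges /corners /=
          /midpoint.
- by have := tri A B C; lra.
- by have := tri B C A; lra.
- have -> : 2^-1 *: (C + A) - C = 2^-1 *: (A - C).
    by apply/colP => i; rewrite !mxE; field.
  by rewrite enormZ ger0_norm ?invr_ge0 //; have := tri C A B; lra.
- have -> : A - 2^-1 *: (C + A) = 2^-1 *: (A - C).
    by apply/colP => i; rewrite !mxE; field.
  by rewrite enormZ ger0_norm ?invr_ge0 //; have := tri C A B; lra.
- by have := tri A B C; lra.
- by have := tri B C A; lra.
- by have := tri C A B; lra.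
Qed.

End Triangle.

Section Incircle.
Context {R : realType}.
Implicit Types (K : cell R) (M : mesh R).
Local Open Scope classical_set_scope.

(** Nonnegativity is what bounds from below the set of diameters whose infimum
    is the mesh size. *)
Lemma incircle_diameter_bounds K : 0 < area K ->
  0 <= incircle_diameter K /\ incircle_diameter K * perimeter K <= 4 * area K.
Proof.
move=> K0; have P0 := perimeter_gt0 K K0; rewrite /incircle_diameter.
set E := (X in sup X).
have ubE : ubound E (4 * area K / perimeter K).
  move=> d [x [r [r0 sub ->]]]; rewrite ler_pdivlMr //.
  by have := inscribed_disc K x r K0 r0 sub; lra.
(* A vertex is a disc of radius 0. *)
have E0 : E 0.
  exists (pA K), 0; split; rewrite ?mulr0 // => y /= y0.
  exists 1, 0, 0; split; rewrite ?ler01 ?addr0 //.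
  rewrite scale1r !scale0r !addr0.
  have /eqP : enorm (y - pA K) = 0 by apply/le_anti; rewrite y0 enorm_ge0.
  rewrite -sqrf_eq0 enorm_sqr dotE -!expr2 paddr_eq0 ?sqr_ge0 // !sqrf_eq0 !mxE.
  rewrite !subr_eq0 => /andP[/eqP e0 /eqP e1].
  apply/colP => i; have /orP[/eqP->|/eqP->] // : (i == 0) || (i == 1).
  by case: i => [[|[|]]].
split; first by apply: ub_le_sup => //; exists (4 * area K / perimeter K).
by rewrite -ler_pdivlMr //; apply: ge_sup => //; exists 0.
Qed.

Lemma mesh_size_le M (T : cell_index M) :
  mesh_size M * perimeter (M T) <= 4 * area (M T).
Proof.
have A0 := area_gt0 (m := M) T; have [_ le_d] := incircle_diameter_bounds _ A0.
apply: le_trans le_d; apply: ler_wpM2r; first exact/ltW/perimeter_gt0.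
have lb : has_lbound (range (fun T' => incircle_diameter (M T'))).
  exists 0 => _ [T' _ <-].
  by have [] := incircle_diameter_bounds _ (area_gt0 (m := M) T').
by apply: (ge_inf lb); exists T.
Qed.

End Incircle.

(** * Convexity of the set of admissible states and flux splitting *)

Section Admissible.
Context {R : realType} (g : R).
Hypothesis g_gt1 : 1 < g.
Implicit Types (u w : 'cV[R]_4) (n : 'cV[R]_2).

Lemma admissibleE u : admissible g u <->
  0 < density u /\ (momx u ^+ 2 + momy u ^+ 2) / (2 * density u) < energy u.
Proof. by rewrite /admissible /= /pressure pmulr_rgt0 ?subr_gt0. Qed.

(** Convexity of [a ^ 2 / r], in homogeneous form. *)
Lemma sqr_div_subadd (a b r s : R) : 0 < r -> 0 < s ->
  (a + b) ^+ 2 / (r + s) <= a ^+ 2 / r + b ^+ 2 / s.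
Proof.
move=> r0 s0; rewrite -subr_ge0.
have -> : a ^+ 2 / r + b ^+ 2 / s - (a + b) ^+ 2 / (r + s)
    = (a * s - b * r) ^+ 2 / (r * s * (r + s)).
  by field; rewrite !gt_eqF ?addr_gt0.
by rewrite divr_ge0 ?sqr_ge0 // !mulr_ge0 ?addr_ge0 ?ltW.
Qed.

(** The kinetic energy is subadditive by [sqr_div_subadd] and homogeneous of
    degree one, so the internal energy can only grow. *)
Lemma admissible_addZ u w (k : R) : 0 <= k ->
  admissible g u -> admissible g w -> admissible g (u + k *: w).
Proof.
rewrite le_eqVlt => /orP[/eqP<-|k0]; first by rewrite scale0r addr0.
move=> /admissibleE[ru eu] /admissibleE[rw ew]; apply/admissibleE.
move: ru eu rw ew; rewrite /density /momx /momy /energy !mxE.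
move=> ru eu rw ew; split; first by rewrite addr_gt0 ?mulr_gt0.
set r := u 0 0 in ru eu *; set s := w 0 0 in rw ew *.
have r0 : 0 < 2 * r by lra.
have s0 : 0 < 2 * (k * s) by rewrite mulr_gt0 ?mulr_gt0.
have hx := sqr_div_subadd (u 1 0) (k * w 1 0) _ _ r0 s0.
have hy := sqr_div_subadd (u 2 0) (k * w 2 0) _ _ r0 s0.
have kew : k * ((w 1 0 ^+ 2 + w 2 0 ^+ 2) / (2 * s)) < k * w 3 0.
  by rewrite ltr_pM2l.
have ek : k * ((w 1 0 ^+ 2 + w 2 0 ^+ 2) / (2 * s))
    = (k * w 1 0) ^+ 2 / (2 * (k * s)) + (k * w 2 0) ^+ 2 / (2 * (k * s)).
  by field; rewrite !gt_eqF.
rewrite mulrDr mulrDl; rewrite ek in kew; rewrite mulrDl in eu.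
lra.
Qed.

Lemma admissible_sum (I : finType) (f : I -> 'cV[R]_4) u :
    (forall i w, admissible g w -> admissible g (w + f i)) ->
  admissible g u -> admissible g (u + \sum_i f i).
Proof.
move=> stable; elim/big_rec: _ u => [|i w _ IH] u u_adm; first by rewrite addr0.
by rewrite addrA; apply/IH/stable.
Qed.

Lemma wave_speed_ge0 u : 0 <= wave_speed g u.
Proof. by rewrite addr_ge0 ?sqrtr_ge0. Qed.

(** Let [vn] be the normal velocity and [s = a - vn], which is at least the
    sound speed.  The state is [s] times [u] minus the pressure contribution
    [(0, p n, p vn)], and its internal energy is
    [s p / (g - 1) - p ^ 2 / (2 s r)].  This is positive because
    [s ^ 2 r >= g p > (g - 1) p / 2]. *)
Lemma admissible_flux_splitting u n (a : R) : admissible g u -> enorm n = 1 ->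
  wave_speed g u <= a -> admissible g (a *: u - euler_flux g u *m n).
Proof.
move=> [r0 p0] n1 le_a.
have nn : n 0 0 ^+ 2 + n 1 0 ^+ 2 = 1.
  by rewrite !expr2 -dotE -enorm_sqr n1 expr1n.
set vn := velx u * n 0 0 + vely u * n 1 0.
have le_vn : vn <= enorm (velocity u).
  have := dot_le_enorm (velocity u) n.
  by rewrite n1 mulr1 dotE !mxE.
have g_gt0 : 0 < g := lt_trans ltr01 g_gt1.
have c2_gt0 : 0 < g * pressure g u / density u.
  by apply: divr_gt0 => //; apply: mulr_gt0.
have cc : sound_speed g u ^+ 2 = g * pressure g u / density u.
  exact/sqr_sqrtr/ltW.
have c0 : 0 < sound_speed g u.
  by rewrite sqrtr_gt0.
set s := a - vn.
have le_cs : sound_speed g u <= s by move: le_a; rewrite /wave_speed /s; lra.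
have s0 : 0 < s by apply: lt_le_trans le_cs.
have : sound_speed g u ^+ 2 <= s ^+ 2 by rewrite ler_pXn2r // nnegrE ltW.
rewrite cc ler_pdivrMr // => le_ss.
have mx : momx u = density u * velx u by rewrite mulrC divfK ?gt_eqF.
have my : momy u = density u * vely u by rewrite mulrC divfK ?gt_eqF.
have E : energy u = pressure g u / (g - 1)
    + density u * (velx u ^+ 2 + vely u ^+ 2) / 2.
  rewrite /pressure /velx /vely; field.
  by rewrite gt_eqF //= subr_eq0 gt_eqF.
set r := density u in r0 le_ss mx my E *; set p := pressure g u in p0 le_ss E *.
set w := _ - _.
have wE i : w i 0
    = a * u i 0 - (euler_flux g u i 0 * n 0 0 + euler_flux g u i 1 * n 1 0).
  rewrite [w i 0]mxE [X in X + _]mxE [X in _ + X]mxE [X in _ - X]mxE.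
  rewrite !big_ord_recl big_ord0 addr0.
  by congr (_ - (_ + euler_flux g u _ _ * n _ _)); apply/val_inj.
have wr : density w = s * r.
  by rewrite /density wE !mxE -/(density u) -/r /= /s /vn; ring.
have wx : momx w = s * r * velx u - p * n 0 0.
  by rewrite /momx wE !mxE -/(momx u) /= mx /s /vn -/r -/p; ring.
have wy : momy w = s * r * vely u - p * n 1 0.
  by rewrite /momy wE !mxE -/(momy u) /= my /s /vn -/r -/p; ring.
have we : energy w = s * energy u - p * vn.
  by rewrite /energy wE !mxE -/(energy u) /= /s /vn -/r -/p; ring.
apply/admissibleE; rewrite wr; split; first exact: mulr_gt0.
rewrite wx wy we E -subr_gt0.
have -> : s * (p / (g - 1) + r * (velx u ^+ 2 + vely u ^+ 2) / 2) - p * vn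
  - ((s * r * velx u - p * n 0 0) ^+ 2 + (s * r * vely u - p * n 1 0) ^+ 2)
    / (2 * (s * r))
  = p * (2 * (s ^+ 2 * r) - (g - 1) * p * (n 0 0 ^+ 2 + n 1 0 ^+ 2))
    / (2 * (g - 1) * (s * r)).
  rewrite /vn; field.
  by rewrite !gt_eqF //= ?subr_gt0.
have g0 : 0 < g - 1 by rewrite subr_gt0.
have gp : 0 < (g - 1) * p := mulr_gt0 g0 p0.
have sr : 0 < s * r := mulr_gt0 s0 r0.
have g2 : 0 < 2 * (g - 1) by lra.
rewrite nn mulr1; apply: divr_gt0 (mulr_gt0 g2 sr); apply: (mulr_gt0 p0).
lra.
Qed.

End Admissible.

(** * The maximal wave speed and the time step restriction *)

Section WaveSpeed.
Context {R : realType} (M : mesh R) (g : R).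
Variables (u : cell_index M -> 'cV[R]_4) (L : cell_index M -> 'M[R]_(4, 2)).

(** A supremum dominates its set only if the set is bounded above; here the sum
    over the finitely many edges is a bound. *)
Lemma max_wave_speed_ge (T : cell_index M) (j : 'I_(nedges (M T))) :
  wave_speed g (interior_trace g u L T j) <= max_wave_speed g u L /\
  wave_speed g (exterior_trace g u L j) <= max_wave_speed g u L.
Proof.
pose ws T (j : 'I_(nedges (M T))) :=
  wave_speed g (interior_trace g u L T j)
  + wave_speed g (exterior_trace g u L j).
have ws_ge0 T' j' : 0 <= ws T' j' by rewrite addr_ge0 ?wave_speed_ge0.
rewrite /max_wave_speed; set E := (X in sup X).
have ubE : ubound E (\sum_T' \sum_j' ws T' j').
  move=> x [T' [j' xE]]; apply: (@le_trans _ _ (ws T' j')).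
    by case: xE => ->; rewrite /ws ?lerDl ?lerDr wave_speed_ge0.
  rewrite (bigD1 T') //= (bigD1 j') //= -addrA lerDl addr_ge0 ?sumr_ge0 //.
  by move=> T'' _; rewrite sumr_ge0.
have hE : has_ubound E by exists (\sum_T' \sum_j' ws T' j').
by split; apply: (ub_le_sup hE); exists T, j; [left|right].
Qed.

End WaveSpeed.

(** The left-hand side is the total coefficient with which the interior trace
    enters the update negatively; the bound combines [mesh_size_le], which
    brings in the perimeter, with [edge_length_le], which removes it. *)
Lemma CFL_edge (R : realType) (M : mesh R) (a dt beta : R) (T : cell_index M)
    (j : 'I_(nedges (M T))) : 0 <= a -> 0 < dt -> 0 <= beta ->
    a * dt <= 2^-1 * beta * mesh_size M ->
  a * dt * edge_length (M T) j / area (M T) <= beta * edge_share (M T) j.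
Proof.
move=> a0 dt0 beta0 CFL; have A0 := area_gt0 (m := M) T.
rewrite ler_pdivrMr //.
have adt0 : 0 <= a * dt by rewrite mulr_ge0 // ltW.
have share0 : 0 <= edge_share (M T) j.
  by rewrite /edge_share; case: ifP; rewrite ?invr_ge0 ?ler01.
have P0 := ltW (perimeter_gt0 _ A0).
have h1 := ler_wpM2l adt0 (edge_length_le _ j).
have h2 := ler_wpM2r P0 CFL.
have h3 := ler_wpM2l beta0 (mesh_size_le M T).
have h4 : a * dt * perimeter (M T) <= 2 * beta * area (M T) by lra.
have := ler_wpM2l share0 h4; lra.
Qed.

(** * Positivity of the finite volume scheme *)

Theorem theorem4p2 (R : realType) (M : mesh R) (g : R)
    (u : cell_index M -> 'cV[R]_4) (L : cell_index M -> 'M[R]_(4, 2))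
    (dt beta : R)
    (g_gt1 : 1 < g)
    (dt_gt0 : 0 < dt)
    (traces_adm : forall (T : cell_index M) (j : 'I_(nedges (M T))),
       admissible g (interior_trace g u L T j))
    (beta_gt0 : 0 < beta) (beta_le1 : beta <= 1)
    (beta_triangle : forall T : cell_index M, ~~ twin (M T) ->
       admissible g
         (u T - beta *: (interior_trace g u L T 0 + interior_trace g u L T 1
                         + interior_trace g u L T 2)))
    (beta_twin : forall T : cell_index M, twin (M T) ->
       admissible g
         (u T - beta *: (interior_trace g u L T 0 + interior_trace g u L T 1
                         + 2^-1 *: interior_trace g u L T 2
                         + 2^-1 *: interior_trace g u L T 3)))
    (CFL : max_wave_speed g u L * dt <= 2^-1 * beta * mesh_size M) :
  forall T : cell_index M, interior_cell T ->
    admissible g (fv_step g u L dt T).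
Proof.
move=> T _.
set a := max_wave_speed g u L in CFL *.
pose um (j : 'I_(nedges (M T))) := interior_trace g u L T j.
pose up (j : 'I_(nedges (M T))) := exterior_trace g u L j.
have up_adm j : admissible g (up j).
  by rewrite /up /exterior_trace; case: partner => [[T' j']|]; apply: traces_adm.
(* One weighted sum covers both assumptions on [beta]. *)
have base : admissible g
    (u T - beta *: \sum_(j < nedges (M T)) edge_share (M T) j *: um j).
  rewrite /um /edge_share /nedges /corners; case: ifP => [tw|/negbT tw] /=.
    rewrite !big_ord_recl big_ord0 /= !scale1r addr0 !addrA.
    exact: beta_twin.
  rewrite !big_ord_recl big_ord0 /= !scale1r addr0 !addrA.
  exact: beta_triangle.
have A0 := area_gt0 (m := M) T.
(* The update is [base] plus admissible states with the nonnegative coefficients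
   [slack j] and [k j]. *)
pose k (j : 'I_(nedges (M T))) := dt * edge_length (M T) j / (2 * area (M T)).
have k0 j : 0 <= k j.
  apply: divr_ge0; first exact: mulr_ge0 (ltW dt_gt0) (enorm_ge0 _).
  by rewrite mulr_ge0 // ltW.
pose slack (j : 'I_(nedges (M T))) := beta * edge_share (M T) j
                - a * dt * edge_length (M T) j / area (M T).
pose part (w : 'cV[R]_4) (j : 'I_(nedges (M T))) :=
  a *: w - euler_flux g w *m normal T j.
rewrite /fv_step -/a (_ : _ - _ =
  (u T - beta *: \sum_(j < nedges (M T)) edge_share (M T) j *: um j)
  + \sum_j (slack j *: um j + k j *: part (um j) j + k j *: part (up j) j)).
  apply: admissible_sum base => j w w_adm.
  have [le_um le_up] := max_wave_speed_ge M g u L T j.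
  have n1 : enorm (normal T j) = 1 by have [] := Defs.normalP j.
  rewrite !addrA; apply: admissible_addZ => //; last first.
    exact: admissible_flux_splitting (up_adm j) n1 le_up.
  apply: admissible_addZ => //; last first.
    exact: admissible_flux_splitting (traces_adm T j) n1 le_um.
  apply: admissible_addZ => //; last exact: traces_adm.
  rewrite subr_ge0; apply: CFL_edge => //; last exact: ltW.
  exact: le_trans (wave_speed_ge0 _ _) le_um.
rewrite -addrA; congr (_ + _).
rewrite !scaler_sumr -!sumrN -big_split /=; apply: eq_bigr => j _.
rewrite /lax_friedrichs -/(um j) -/(up j) mulmxDl /slack /part /k.
move: (euler_flux g (um j) *m _) (euler_flux g (up j) *m _) => Fm Fp.
apply/colP => i; rewrite !mxE; field.
by rewrite gt_eqF.
Qed.
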